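(* For any odd prime $p$ and integer $d\not\equiv0\pmod p$, we have $$\operatorname{per}[j+dk]_{1\le j,k\le p-1}\equiv2\pmod p$$ and $$\operatorname{per}[j^2+dk^2]_{1\le j,k\le (p-1)/2}\equiv(-1)^{(p+1)/2}\left(1+\left(\frac dp\right)\right)\frac{p-1}{2}!\pmod p.$$
   Context: The permanent of an $N\times N$ matrix $A=[a_{j,k}]$ is $\operatorname{per}(A)=\sum_{\tau\in S_N}\prod_{j=1}^{N}a_{j,\tau(j)}$. $\left(\frac{d}{p}\right)$ denotes the Legendre (Jacobi) symbol, and $\frac{p-1}{2}!$ means $((p-1)/2)!$. *)

(* Defs.v *)
From mathcomp Require Import all_boot all_order all_fingroup all_algebra.

Set Implicit Arguments.
Unset Strict Implicit.
Unset Printing Implicit Defensive.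

Import GRing.Theory.
Local Open Scope ring_scope.

Definition permanent (R : comNzRingType) (n : nat) (A : 'M[R]_n) : R :=
  \sum_(s : 'S_n) \prod_(i < n) A i (s i).

(* Only meaningful when p is an odd prime.  The square root of a modulo p is
   searched among the residues 0, ..., p - 1. *)
Definition legendre (a : int) (p : nat) : int :=
  if (p%:Z %| a)%Z then 0
  else if [exists x : 'I_p, ((x%:Z ^+ 2)%R == a %[mod p%:Z])%Z] then 1
  else -1.

(* Main.v *)
Require Import Defs.
From mathcomp Require Import all_boot all_order all_fingroup all_algebra.
From mathcomp Require Import cyclic finfield.

Set Implicit Arguments.
Unset Strict Implicit.
Unset Printing Implicit Defensive.

Import GRing.Theory.
Local Open Scope ring_scope.

(** Modulo p, the numbers 1, ..., p - 1 are the roots of X^n - 1 for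
    n = p - 1, and the squares 1^2, ..., ((p-1)/2)^2 are its roots for
    n = (p-1)/2.  Both congruences are therefore instances of one identity in
    a field: if x_1, ..., x_n are the n distinct n-th roots of unity, then
      per [x_j + d x_k] = n! (-1)^(n+1) (1 + d^n)
    ([permanent_unity_roots]).

    Expanding every factor of the products that make up per [u_j + y_k] gives
      sum over T of (prod_(j notin T) u_j) * c_T,
      where c_T = sum over t in S_n of prod_(j in T) y_(t j).
    When the y_k are the multiples d x_k of the roots of unity, multiplication
    by a primitive n-th root of unity z permutes them.  Reindexing the sum over
    t by that permutation shows c_T = z^|T| c_T, hence c_T = 0 unless T is
    empty or full ([sum_perm_prod_eq0]).  The two surviving terms give
    n! (prod_j u_j + prod_k y_k) ([permanent_add_scaled]); the product of the
    roots of unity is (-1)^(n+1), as the constant term of X^n - 1 shows.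

    For n = p - 1, Wilson's theorem and Fermat's little theorem turn the right
    hand side into 2.  For n = (p-1)/2, Euler's criterion ([Fp_legendre])
    identifies d^n with the Legendre symbol of d. *)

(** * Permanents of matrices of sums *)

Lemma rmorph_permanent (R S : comNzRingType) (f : {rmorphism R -> S}) (n : nat)
    (A : 'M[R]_n) :
  f (permanent A) = permanent (map_mx f A).
Proof.
rewrite rmorph_sum; apply: eq_bigr => s _.
by rewrite rmorph_prod; apply: eq_bigr => i _; rewrite mxE.
Qed.

(** The sum is invariant under right translation by [s], which also multiplies
    each of its terms by [z ^+ #|T|]. *)
Lemma sum_perm_prod_eq0 (R : idomainType) (n : nat) (y : 'I_n -> R)
    (s : 'S_n) (z : R) (T : {set 'I_n}) :
    (forall k, y (s k) = z * y k) -> z ^+ #|T| != 1 ->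
  \sum_(t : 'S_n) \prod_(i in T) y (t i) = 0.
Proof.
move=> ys zT; set c := LHS.
have : c = z ^+ #|T| * c.
  rewrite {1}/c (reindex_inj (mulIg s)) mulr_sumr; apply: eq_bigr => t _.
  rewrite -prodr_const -big_split; apply: eq_bigr => i _.
  by rewrite permM ys.
move/eqP; rewrite -subr_eq0 -{1}[c]mul1r -mulrBl mulf_eq0 subr_eq0 eq_sym.
by rewrite (negbTE zT) => /eqP.
Qed.

(** In the expansion over subsets [T] of the rows where the summand [y] is
    chosen, a primitive root [z] kills every term except those of the empty and
    of the full subset, because [z ^+ #|T|] is 1 only for these. *)
Lemma permanent_add_scaled (R : idomainType) (n : nat) (u y : 'I_n -> R)
    (s : 'S_n) (z : R) :
    n.-primitive_root z -> (forall k, y (s k) = z * y k) ->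
  permanent (\matrix_(j < n, k < n) (u j + y k))
    = n`!%:R * (\prod_j u j + \prod_k y k).
Proof.
move=> zP ys; have n_gt0 := prim_order_gt0 zP.
transitivity (\sum_(T : {set 'I_n})
    (\sum_(t : 'S_n) \prod_(i in T) y (t i)) * \prod_(i in ~: T) u i).
  rewrite /permanent.
  under eq_bigr => t _.
    under eq_bigr => i _ do rewrite mxE addrC.
    rewrite bigA_distr.
    under eq_bigr => T _.
      rewrite (bigID (mem T)) /=.
      under eq_bigr => i -> do [].
      under [X in _ * X]eq_bigr => i /negbTE -> do [].
      over.
    over.
  rewrite exchange_big; apply: eq_bigr => T _; rewrite mulr_suml.
  apply: eq_bigr => t _; congr (_ * _).
  by apply: eq_bigl => i; rewrite inE.
have setT_neq0 : [set: 'I_n] != set0.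
  by rewrite -card_gt0 cardsT card_ord.
rewrite (bigD1 set0) //= (bigD1 setT) //= [X in _ + (_ + X)]big1
  => [|T /andP[T0 TT]].
  have prod_setT (v : 'I_n -> R) : \prod_(i in [set: 'I_n]) v i = \prod_i v i.
    by apply: eq_bigl => i; rewrite inE.
  have -> : \sum_(t : 'S_n) \prod_(i in set0) y (t i) = n`!%:R.
    under eq_bigr do rewrite big_set0.
    by rewrite sumr_const card_Sn.
  have -> : \sum_(t : 'S_n) \prod_(i in [set: 'I_n]) y (t i)
      = n`!%:R * \prod_k y k.
    transitivity (\sum_(t : 'S_n) \prod_k y k).
      apply: eq_bigr => t _.
      by rewrite prod_setT [RHS](reindex_inj (@perm_inj _ t)).
    by rewrite sumr_const card_Sn mulr_natl.
  by rewrite addr0 setC0 setCT big_set0 mulr1 prod_setT mulrDr.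
(* A nonempty proper subset: n does not divide its cardinality. *)
rewrite (sum_perm_prod_eq0 ys) ?mul0r // -(prim_order_dvd zP).
rewrite gtnNdvd ?card_gt0 //.
by rewrite -[X in (_ < X)%N]card_ord -cardsT proper_card // properT.
Qed.

(** * Enumerations of the roots of unity of a field *)

Section UnityRoots.

Variables (F : fieldType) (n : nat) (x : 'I_n -> F).
Hypotheses (n_gt0 : (0 < n)%N) (x_inj : injective x).
Hypothesis (x_root : forall k, x k ^+ n = 1).

Let rs := [seq x k | k <- enum 'I_n].

Let rs_size : size rs = n.
Proof. by rewrite size_map size_enum_ord. Qed.

Let rs_uniq : uniq rs.
Proof. by rewrite map_inj_uniq ?enum_uniq. Qed.

Let rs_roots : all n.-unity_root rs.
Proof.
by apply/allP => _ /mapP[k _ ->]; apply/unity_rootP; rewrite x_root.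
Qed.

Lemma unity_root_enumerated (w : F) : w ^+ n = 1 -> exists k, w = x k.
Proof.
move=> /unity_rootP wn.
have := mem_unity_roots n_gt0 rs_roots rs_uniq rs_size w.
by rewrite [LHS]wn => /esym/mapP[k _ ->]; exists k.
Qed.

(** Compare the constant terms of X^n - 1 and of its factorization. *)
Lemma prod_unity_roots : \prod_k x k = (-1) ^+ n.+1.
Proof.
have sz : size ('X^n - 1 : {poly F}) = (size rs).+1.
  by rewrite rs_size size_XnsubC.
have := all_roots_prod_XsubC sz rs_roots.
rewrite uniq_rootsE => /(_ rs_uniq).
rewrite (monicP (monicXnsubC _ n_gt0)) scale1r => /(congr1 (fun q => q.[0])).
rewrite hornerD hornerN hornerXn hornerC expr0n eqn0Ngt n_gt0 /= sub0r.
rewrite horner_prod big_map big_enum /=.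
under eq_bigr do rewrite hornerXsubC sub0r.
rewrite prodrN card_ord => e.
by rewrite exprSr {2}e signrMK.
Qed.

(** A primitive root occurs among the [x k] since they form a finite
    multiplicative group of order [n] in a field, and multiplication by it
    permutes them. *)
Lemma permanent_unity_roots (d : F) :
  permanent (\matrix_(j < n, k < n) (x j + d * x k))
    = n`!%:R * (-1) ^+ n.+1 * (1 + d ^+ n).
Proof.
have /hasP[z _ zP] : has n.-primitive_root rs.
  by apply: has_prim_root; rewrite ?rs_size.
have zx k : exists l, x l == z * x k.
  have [|l ->] := @unity_root_enumerated (z * x k); last by exists l.
  by rewrite exprMn x_root (prim_expr_order zP) mulr1.
pose f k := xchoose (zx k).
have fE k : x (f k) = z * x k by apply/eqP/(xchooseP (zx k)).
have z0 : z != 0.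
  by apply: contra_eq_neq (prim_expr_order zP) => ->;
     rewrite expr0n eqn0Ngt n_gt0 eq_sym oner_eq0.
have f_inj : injective f.
  by move=> k l /(congr1 x); rewrite !fE => /(mulfI z0)/x_inj.
rewrite (@permanent_add_scaled _ _ x (fun k => d * x k) (perm f_inj) z) //.
  rewrite big_split /= prodr_const card_ord prod_unity_roots.
  by rewrite -{1}[_ ^+ n.+1]mul1r -mulrDl -mulrA [(1 + _) * _]mulrC.
by move=> k; rewrite permE fE mulrCA.
Qed.

End UnityRoots.

(** * Residues modulo an odd prime *)

Section PrimeField.

Variable p : nat.
Hypotheses (p_prime : prime p) (p_odd : odd p).

Lemma eqz_mod_Fp (a b : int) :
  ((a == b %[mod p%:Z])%Z) = (a%:~R == b%:~R :> 'F_p).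
Proof.
by rewrite eqz_mod_dvd (dvdz_pcharf (pchar_Fp p_prime)) intrB subr_eq0.
Qed.

Lemma Fp_expf_pred (a : 'F_p) : a != 0 -> a ^+ p.-1 = 1.
Proof.
move=> a0; apply: (mulfI a0).
by rewrite -exprS prednK ?prime_gt0 // mulr1 -{2}[a]expf_card card_Fp.
Qed.

Lemma Fp_fact_pred : (p.-1)`!%:R = -1 :> 'F_p.
Proof.
apply/eqP; rewrite -subr_eq0 opprK -[X in _ + X]/(1%:R) -natrD addn1.
by rewrite -(dvdn_pcharf (pchar_Fp p_prime)) -Wilson ?prime_gt1.
Qed.

Lemma Fp_nat_eq (a b : nat) : (a < p)%N -> (b < p)%N ->
  (a%:R == b%:R :> 'F_p) = (a == b).
Proof.
move=> ap bp; have := eqz_mod_Fp a b; rewrite -!pmulrn => <-.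
by rewrite !modz_small // le0z_nat ltz_nat.
Qed.

Lemma Fp_natS_neq0 (k : nat) : (k < p.-1)%N -> k.+1%:R != 0 :> 'F_p.
Proof.
by move=> kp; rewrite (@Fp_nat_eq _ 0) ?prime_gt0 // -ltn_predRL.
Qed.

Lemma Fp_natS_inj : injective (fun k : 'I_p.-1 => k.+1%:R : 'F_p).
Proof.
move=> j k /eqP; rewrite Fp_nat_eq -?ltn_predRL // => /eqP[].
exact: val_inj.
Qed.

Let pred_p_half : p.-1 = (p.-1./2).*2.
Proof.
by rewrite -[LHS]odd_double_half -subn1 oddB ?prime_gt0 // p_odd.
Qed.

Lemma half_pred_gt0 : (0 < p.-1./2)%N.
Proof. by rewrite -double_gt0 -pred_p_half ltn_predRL prime_gt1. Qed.

Let half_lt_pred k : (k < p.-1./2)%N -> (k < p.-1)%N.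
Proof.
by move=> kh; rewrite pred_p_half -addnn (leq_trans kh) ?leq_addr.
Qed.

(** If j^2 = k^2 then j = k or j + k = 0, and the latter is impossible since
    0 < j + k < p for j and k at most (p-1)/2. *)
Lemma Fp_natS_sqr_inj :
  injective (fun k : 'I_p.-1./2 => k.+1%:R ^+ 2 : 'F_p).
Proof.
move=> j k /eqP.
have jp := ltn_ord j; have kp := ltn_ord k.
rewrite eqf_sqr => /orP[|].
  rewrite Fp_nat_eq -?ltn_predRL ?half_lt_pred // => /eqP[].
  exact: val_inj.
rewrite -subr_eq0 opprK -natrD addSn (negbTE (Fp_natS_neq0 _)) //.
by rewrite [X in (_ < X)%N]pred_p_half -addnn -addSn leq_add.
Qed.

Lemma Fp_natS_sqr_root (k : 'I_p.-1./2) : (k.+1%:R ^+ 2 : 'F_p) ^+ p.-1./2 = 1.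
Proof.
rewrite -exprM mul2n -pred_p_half Fp_expf_pred // Fp_natS_neq0 //.
exact: half_lt_pred.
Qed.

(** Euler's criterion.  For nonzero [a], the power on the right squares to 1, so
    it is 1 or -1.  If it is 1, then [a] is a root of X^((p-1)/2) - 1, and all
    the roots of this polynomial are squares because 1^2, ..., ((p-1)/2)^2
    already exhaust them. *)
Lemma Fp_legendre (a : int) :
  (legendre a p)%:~R = a%:~R ^+ p.-1./2 :> 'F_p.
Proof.
rewrite /legendre (dvdz_pcharf (pchar_Fp p_prime)).
have [->|a0] := eqVneq; first by rewrite expr0n eqn0Ngt half_pred_gt0.
case: existsP => [[x]|nsq].
  rewrite eqz_mod_Fp rmorphXn /= => /eqP xa.
  rewrite -xa -exprM mul2n -pred_p_half Fp_expf_pred //.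
  by apply: contraNneq a0 => x0; rewrite -xa x0 expr0n.
have /eqP : (a%:~R ^+ p.-1./2 : 'F_p) ^+ 2 = 1.
  by rewrite -exprM muln2 -pred_p_half Fp_expf_pred.
rewrite sqrf_eq1 => /orP[/eqP a1|/eqP->]; last by rewrite rmorphN.
have [k ak] := unity_root_enumerated half_pred_gt0 Fp_natS_sqr_inj
  Fp_natS_sqr_root a1.
case: nsq; have kp : (k.+1 < p)%N by rewrite -ltn_predRL half_lt_pred.
by exists (Ordinal kp); rewrite eqz_mod_Fp rmorphXn /= ak.
Qed.

End PrimeField.

(** * The two congruences *)

Theorem corollary1 (p : nat) (d : int)
    (p_prime : prime p) (p_odd : odd p) (d_nz : (d != 0 %[mod p%:Z])%Z) :
  (permanent (\matrix_(j < p.-1, k < p.-1) (j.+1%:Z + d * k.+1%:Z))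
     = 2 %[mod p%:Z])%Z
  /\
  (permanent (\matrix_(j < p.-1./2, k < p.-1./2)
                (j.+1%:Z ^+ 2 + d * k.+1%:Z ^+ 2)%R)
     = ((-1) ^+ p.+1./2 * (1 + legendre d p) * (p.-1./2)`!%:Z)%R
     %[mod p%:Z])%Z.
Proof.
have p_gt0 := prime_gt0 p_prime.
have p1_gt0 : (0 < p.-1)%N by rewrite ltn_predRL prime_gt1.
have d0 : d%:~R != 0 :> 'F_p by rewrite eqz_mod_Fp in d_nz.
split; apply/eqP; rewrite eqz_mod_Fp // (rmorph_permanent (intmul 1));
  apply/eqP.
  have -> : map_mx (intmul (1 : 'F_p))
      (\matrix_(j < p.-1, k < p.-1) (j.+1%:Z + d * k.+1%:Z))
    = \matrix_(j < p.-1, k < p.-1) (j.+1%:R + d%:~R * k.+1%:R).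
    by apply/matrixP => j k; rewrite !mxE rmorphD rmorphM.
  rewrite (permanent_unity_roots p1_gt0 (@Fp_natS_inj _ p_prime)); last first.
    by move=> k; rewrite Fp_expf_pred // Fp_natS_neq0.
  rewrite Fp_expf_pred // prednK // -signr_odd p_odd expr1 mulrN1.
  by rewrite Fp_fact_pred // opprK mul1r.
have -> : map_mx (intmul (1 : 'F_p))
    (\matrix_(j < p.-1./2, k < p.-1./2) (j.+1%:Z ^+ 2 + d * k.+1%:Z ^+ 2))
  = \matrix_(j < p.-1./2, k < p.-1./2) (j.+1%:R ^+ 2 + d%:~R * k.+1%:R ^+ 2).
  by apply/matrixP => j k; rewrite !mxE rmorphD rmorphM !rmorphXn.
rewrite permanent_unity_roots.
- rewrite -Fp_legendre // !rmorphM rmorphD rmorphXn rmorphN /=.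
  have -> : (p.-1./2).+1 = p.+1./2 by rewrite -{2}(prednK p_gt0).
  by rewrite -mulrA mulrC.
- exact: half_pred_gt0.
- exact: Fp_natS_sqr_inj.
- exact: Fp_natS_sqr_root.
Qed.
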